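(* Let $G$ be a finitely generated abelian group. There exists a symmetric subset $S$ of $G$ such that $\mathrm{Cay}(G,S)$ is connected and has chromatic number exactly $3$ if and only if $\exp(G)\notin\{1,2,4\}$.
   Context: A subset $S$ of an abelian group $G$ (written additively) is symmetric if $s\in S$ iff $-s\in S$. $\mathrm{Cay}(G,S)$ is the graph on vertex set $G$ with $x,y$ adjacent iff $y-x\in S$. The exponent $\exp(G)$ is the least positive integer $k$ with $kg=0$ for all $g\in G$, and $\exp(G)=0$ if no such $k$ exists. *)

(* Defs.v *)
From mathcomp Require Import all_boot all_order all_algebra.
From mathcomp Require Import boolp classical_sets.

Set Implicit Arguments.
Unset Strict Implicit.
Unset Printing Implicit Defensive.

Import GRing.Theory.

Local Open Scope ring_scope.

Definition finitely_generated (G : zmodType) : Prop :=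
  exists (n : nat) (X : n.-tuple G), forall g : G, inIntSpan X g.

Definition annihilates (G : zmodType) (k : nat) : Prop :=
  (0 < k)%N /\ forall g : G, g *+ k = 0.

Lemma ex_annihilates (G : zmodType) :
  (exists k, annihilates G k) -> exists k, `[< annihilates G k >].
Proof. by move=> [k Gk]; exists k; apply/asboolP. Qed.

Definition exponent (G : zmodType) : nat :=
  match pselect (exists k, annihilates G k) with
  | left exk => ex_minn (ex_annihilates exk)
  | right _ => 0%N
  end.

Definition symmetric_subset (G : zmodType) (S : set G) : Prop :=
  forall s : G, S s <-> S (- s).

(* Graphs are given by their adjacency relation. Loops are not excluded here:
   Cay S has loops iff S contains 0, and then it has no proper colouring. *)
Definition Cay (G : zmodType) (S : set G) : rel G := fun x y => y - x \in S.

Definition connected_graph (V : eqType) (adj : rel V) : Prop :=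
  forall x y : V, exists p : seq V, path adj x p /\ last x p = y.

Definition colorable (V : eqType) (adj : rel V) (k : nat) : Prop :=
  exists c : V -> 'I_k, forall x y : V, adj x y -> c x <> c y.

Definition has_chromatic_number (V : eqType) (adj : rel V) (k : nat) : Prop :=
  colorable adj k /\ forall j : nat, colorable adj j -> (k <= j)%N.

(* Main.v *)
(** If [4 g = 0] for all [g], lift the colour differences of a proper 3-colouring
    along edges to integers [+1] or [-1]. Four such steps around a closed walk sum
    to a multiple of 3 in [[-4, 4]] of even parity, hence to 0. So the total along
    a walk is invariant under permuting its steps, and it vanishes on [s, s, s, s].
    A closed walk [l] repeated four times permutes into blocks [s, s, s, s], so the
    total along [l] is 0, whereas its parity is that of the length of [l]: there are
    no odd closed walks and the graph is bipartite.

    Otherwise [G] has an epimorphism [f] to [Z/p] with [p] odd or to [Z/8], and [S]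
    is the preimage of the connection set of an odd cycle or of the Moebius ladder
    on 8 vertices. If [exp G = 0], then [G <> 3G] by Nakayama's lemma, which
    gives an epimorphism to [Z/3]. *)
Require Import Defs.
From HB Require Import structures.
From mathcomp Require Import all_boot all_order all_algebra.
From mathcomp Require Import boolp classical_sets.
From mathcomp Require Import zify.
Set Implicit Arguments.
Unset Strict Implicit.
Unset Printing Implicit Defensive.

Import GRing.Theory.
Local Open Scope ring_scope.

(** * Winding numbers of walks under a 3-colouring *)

(** The lift of [b - a] modulo 3 to [1] or [-1]. At [a = b] the default [-1] keeps every value
    odd. *)
Definition color_step (a b : 'I_3) : int :=
  if (a.+1 %% 3 == b)%N then 1 else -1.

Lemma color_stepC (a b : 'I_3) : a <> b -> color_step a b = - color_step b a.
Proof.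
by case: a b => [[|[|[|//]]] ?] [[|[|[|//]]] ?] //= ne_ab;
  case: ne_ab; apply: val_inj.
Qed.

(* Four signs summing to a multiple of 3 sum to 0. *)
Lemma color_step_square (a b d e : 'I_3) :
  a <> b -> b <> e -> e <> d -> d <> a ->
  color_step a b + color_step b e + color_step e d + color_step d a = 0.
Proof.
by case: a b d e =>
  [[|[|[|//]]] ?] [[|[|[|//]]] ?] [[|[|[|//]]] ?] [[|[|[|//]]] ?] //= ab be ed da;
  (try by case: ab; apply: val_inj); (try by case: be; apply: val_inj);
  (try by case: ed; apply: val_inj); (try by case: da; apply: val_inj).
Qed.

Section Winding.

Variables (G : zmodType) (c : G -> 'I_3).

Fixpoint winding (x : G) (l : seq G) : int :=
  if l is s :: l' then color_step (c x) (c (x + s)) + winding (x + s) l' else 0.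

Lemma winding_cat (x : G) (l1 l2 : seq G) :
  winding x (l1 ++ l2) = winding x l1 + winding (x + \sum_(s <- l1) s) l2.
Proof.
elim: l1 x => [|s l1 IH] x /=; first by rewrite big_nil addr0 add0r.
by rewrite IH big_cons !addrA.
Qed.

Lemma odd_winding (x : G) (l : seq G) :
  exists k : int, winding x l = (size l)%:Z + 2 * k.
Proof.
elim: l x => [|s l IH] x /=; first by exists 0.
have [k ->] := IH (x + s); rewrite /color_step.
by case: ifP => _; [exists k | exists (k - 1)]; lia.
Qed.

Variable S : set G.
Hypothesis proper_c : forall x s, S s -> c x <> c (x + s).

(** The two walks bound the square [x], [x + s], [x + s + t], [x + t], around which the total is
    0. *)
Lemma winding_swap (x : G) (s t : G) : S s -> S t ->
  winding x [:: s; t] = winding x [:: t; s].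
Proof.
move=> Ss St /=; rewrite !addr0 [x + t + s]addrAC.
have := @color_step_square (c x) (c (x + s)) (c (x + t)) (c (x + s + t)).
have := @color_stepC (c x) (c (x + t)) (proper_c (x := x) St).
have nt : c (x + t) <> c (x + s + t) by rewrite addrAC; apply: proper_c.
have := color_stepC nt.
move=> e1 e2 /(_ (proper_c (x:=x) Ss) (proper_c (x:=x+s) St)).
move=> /(_ (fun h => nt (esym h)) (fun h => proper_c (x:=x) St (esym h))).
by rewrite e1 e2 -opprD -addrA => /eqP; rewrite addr_eq0 => /eqP ->; rewrite [X in - X]addrC.
Qed.

Lemma winding_consC (x s : G) (l : seq G) : S s -> (forall t, t \in l -> S t) ->
  winding x (s :: l) = winding x (l ++ [:: s]).
Proof.
move=> Ss; elim: l x => [//|t l IH] x Sl.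
have St : S t by apply: Sl; rewrite mem_head.
have {}Sl u : u \in l -> S u by move=> ul; apply: Sl; rewrite inE ul orbT.
rewrite [RHS]/= -IH //=.
by have /= := winding_swap x Ss St; rewrite !addr0 !addrA [x + t + s]addrAC => ->.
Qed.

Lemma winding_catC (x : G) (l1 l2 : seq G) :
  (forall t, t \in l1 -> S t) -> (forall t, t \in l2 -> S t) ->
  winding x (l1 ++ l2) = winding x (l2 ++ l1).
Proof.
elim: l1 x l2 => [|s l1 IH] x l2 Sl1 Sl2; first by rewrite cats0.
have Ss : S s by apply: Sl1; rewrite mem_head.
have {}Sl1 u : u \in l1 -> S u by move=> ul; apply: Sl1; rewrite inE ul orbT.
rewrite /= IH // -[s :: l1]cat1s catA [RHS]winding_cat -winding_consC //= winding_cat.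
by rewrite big_cat big_seq1 /= -!addrA [s + _]addrC.
Qed.

Lemma winding_perm (x : G) (l1 l2 : seq G) : (forall t, t \in l1 -> S t) ->
  perm_eq l1 l2 -> winding x l1 = winding x l2.
Proof.
move=> Sl1 p12.
pose P l := (forall t, t \in l -> S t) /\ winding x l1 = winding x l.
suff [] : P l2 by [].
apply: (catCA_perm_ind _ p12); last by split.
move=> s1 s2 s3 [Sl E]; rewrite /P E; split.
  by move=> t; rewrite !mem_cat orbCA => ts; apply: Sl; rewrite !mem_cat.
rewrite !catA !(winding_cat _ (_ ++ _)) winding_catC.
- by rewrite !big_cat /= [X in x + X]addrC.
- by move=> t ts; apply: Sl; rewrite mem_cat ts.
- by move=> t ts; apply: Sl; rewrite !mem_cat ts orbT.
Qed.

Hypothesis G4 : forall g : G, g *+ 4 = 0.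

(** Since [4 s = 0], the four steps form a closed walk of length 4. *)
Lemma winding_nseq4 (x s : G) : S s -> winding x (nseq 4 s) = 0.
Proof.
move=> Ss /=; rewrite addr0 !addrA.
have E : x + s + s + s + s = x by rewrite -!addrA -[RHS]addr0 -(G4 s) !mulrS mulr0n addr0.
rewrite E; apply: color_step_square; try exact: proper_c.
by rewrite -{2}E; apply: proper_c.
Qed.

Lemma even_closed_walk (l : seq G) :
  (forall t, t \in l -> S t) -> \sum_(s <- l) s = 0 -> ~~ odd (size l).
Proof.
move=> Sl sum0.
have p4 : perm_eq (flatten [seq nseq 4 s | s <- l]) (l ++ l ++ l ++ l).
  apply/permP => a; rewrite !count_cat.
  by elim: l {Sl sum0} => //= s l ->; lia.
have W0 : winding 0 (l ++ l ++ l ++ l) = 0.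
  rewrite -(winding_perm _ _ p4).
    have Wx : forall x, winding x (flatten [seq nseq 4 s | s <- l]) = 0; last exact: Wx.
    elim: l Sl {sum0 p4} => [//|s l IH] Sl x.
    rewrite [flatten _]/= -[_ :: _]/(nseq 4 s ++ flatten [seq nseq 4 s | s <- l]).
    rewrite winding_cat winding_nseq4 ?IH //; last by apply: Sl; rewrite mem_head.
    by move=> t tl; apply: Sl; rewrite inE tl orbT.
  by move=> t; rewrite (perm_mem p4) !mem_cat !orbb => /Sl.
(* As [l] sums to 0, all four copies start at [0] and wind equally, so [winding 0 l = 0]. *)
have [k] := odd_winding 0 l.
move: W0; rewrite !winding_cat sum0 !addr0; lia.
Qed.

End Winding.

(** * Closed walks and bipartiteness of Cayley graphs *)

Section OddWalk.

Variables (G : zmodType) (S : set G).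

Lemma Cay_path_steps (x y : G) :
  (exists p, path (Cay S) x p /\ last x p = y) ->
  exists l : seq G, (forall t, t \in l -> S t) /\ \sum_(s <- l) s = y - x.
Proof.
move=> [p []]; elim: p x => [|z p IH] x /=.
  by move=> _ <-; exists [::]; rewrite big_nil subrr.
case/andP => xz pz lp; have [l [Sl suml]] := IH z pz lp.
exists (z - x :: l); split.
  by move=> t; rewrite inE => /orP[/eqP-> | /Sl //]; move: xz; rewrite /Cay inE.
by rewrite big_cons suml addrC addrA subrK.
Qed.

Lemma bipartite_of_even_closed_walks :
  symmetric_subset S -> connected_graph (Cay S) ->
  (forall l : seq G, (forall t, t \in l -> S t) -> \sum_(s <- l) s = 0 ->
     ~~ odd (size l)) ->
  colorable (Cay S) 2.
Proof.
move=> symS conS evenS.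
have [w Hw] := choice (fun x => Cay_path_steps (conS 0 x)).
exists (fun x => inord (odd (size (w x)))) => x y.
rewrite /Cay inE => Sxy /(congr1 val) /=; rewrite !inordK ?ltnS ?leq_b1 // => par.
have [Sx sx] := Hw x; have [Sy sy] := Hw y.
(* The walk to [x], the edge to [y] and the walk back to [0] close up, with odd length if the
   colours agree. Only the sum of the steps matters, so the way back needs no reversal. *)
have /negP[] : ~~ odd (size (w x ++ (y - x) :: map -%R (w y))).
  apply: evenS; last first.
    by rewrite big_cat big_cons big_map sumrN /= sx sy !subr0 addrA subrKC subrr.
  move=> t; rewrite mem_cat inE => /orP[/Sx //|/orP[/eqP-> //|]].
  by case/mapP => u /Sy Su ->; apply/symS; rewrite opprK.
by move: par; rewrite size_cat /= size_map oddD /=; do 2 case: odd.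
Qed.

End OddWalk.

Lemma Cay_chromatic_neq3 (G : zmodType) (S : set G) :
  (forall g : G, g *+ 4 = 0) -> symmetric_subset S -> connected_graph (Cay S) ->
  ~ has_chromatic_number (Cay S) 3.
Proof.
move=> G4 symS conS [[c proper_c] min3].
suff /min3 : colorable (Cay S) 2 by [].
apply: bipartite_of_even_closed_walks => // l; apply: (even_closed_walk (c := c)) => //.
by move=> x s Ss; apply: proper_c; rewrite /Cay inE addrC addKr.
Qed.

(** Two colours must alternate along the multiples of [g], so the adjacent vertices [0] and [g *+ m]
    would share a colour. *)
Lemma not_bipartite_of_even_multiple (G : zmodType) (S : set G) (g : G) (m : nat) :
  S g -> S (g *+ m) -> ~~ odd m -> ~ colorable (Cay S) 2.
Proof.
move=> Sg Smg evm [c proper_c].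
have alt k : (c (g *+ k) == c 0) = ~~ odd k.
  elim: k => [|k IH]; first by rewrite mulr0n eqxx.
  have := proper_c (g *+ k) (g *+ k.+1); rewrite /Cay inE mulrSr addrC addKr => /(_ Sg).
  rewrite /= -IH; move: (c _) (c _) (c _).
  by case=> [[|[|//]] ?] [[|[|//]] ?] [[|[|//]] ?] ne //; case: ne; apply: val_inj.
apply: (proper_c 0 (g *+ m)); first by rewrite /Cay inE subr0.
by apply/eqP; rewrite eq_sym alt.
Qed.

Lemma colorable_leq (V : eqType) (adj : rel V) (j k : nat) :
  (j <= k)%N -> colorable adj j -> colorable adj k.
Proof.
move=> le_jk [c proper_c]; exists (fun x => widen_ord le_jk (c x)) => x y /proper_c ne.
by move=> /(congr1 val) /= e; apply: ne; apply: val_inj.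
Qed.

(** * Pulling back connection sets along a homomorphism to Z/n *)

Section Pullback.

Variables (G : zmodType) (n : nat) (f : {additive G -> 'Z_n}) (g : G).
Hypotheses (n_gt1 : (1 < n)%N) (fg : f g = 1).

(* Every fibre over 1 lies in the connection set, so the last step of a walk can
   absorb the kernel of f. *)
Lemma Cay_preimage_connected (T : set 'Z_n) :
  T 1 -> connected_graph (Cay (f @^-1` T)%classic).
Proof.
move=> T1 x y.
have walk k : forall x, f (y - x) = k.+1%:R ->
    exists p, path (Cay (f @^-1` T)%classic) x p /\ last x p = y.
  elim: k => [|k IH] z fz.
    by exists [:: y]; rewrite /= andbT /Cay inE /= fz.
  have [|p [zp lp]] := IH (z + g).
    by rewrite opprD addrA raddfB /= fz fg -[k.+2]addn1 natrD addrK.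
  exists (z + g :: p); split=> //=.
  by rewrite zp andbT /Cay inE /= addrC addKr fg.
(* Adding [n] keeps the number of steps positive even when [f (y - x) = 0]. *)
apply: (walk (f (y - x) + n).-1).
by rewrite prednK ?natrD ?pchar_Zp ?addr0 ?natr_Zp //; lia.
Qed.

(** The composite of [c] and [f] is a 3-colouring, while [g] and [g *+ m], lifting [1] and [m%:R],
    rule out two colours. *)
Lemma Cay_preimage_chromatic3 (T : set 'Z_n) (c : 'Z_n -> 'I_3) (m : nat) :
  (forall a, T a <-> T (- a)) -> T 1 -> T m%:R -> ~~ odd m ->
  (forall a t, T t -> c a <> c (a + t)) ->
  exists S : set G, symmetric_subset S /\ connected_graph (Cay S)
    /\ has_chromatic_number (Cay S) 3.
Proof.
move=> symT T1 Tm evm proper_c; exists (f @^-1` T)%classic; split.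
  by move=> s; rewrite /= raddfN; apply: symT.
split; first exact: Cay_preimage_connected.
split.
  exists (c \o f) => x y; rewrite /Cay inE /= => Txy.
  by have := proper_c (f x) _ Txy; rewrite -raddfD /= addrC subrK.
move=> j cj; rewrite leqNgt; apply/negP => j_lt3.
apply: (@not_bipartite_of_even_multiple _ (f @^-1` T)%classic g m) evm _.
- by rewrite /= fg.
- by rewrite /= raddfMn /= fg.
- exact: colorable_leq cj.
Qed.

End Pullback.

(** * Odd cycles and the Moebius ladder on 8 vertices *)

Definition cycle_color (n : nat) (a : 'Z_n) : 'I_3 :=
  if a == -1 then inord 2 else inord (odd a).

Lemma cycle_color_succ (n : nat) (a : 'Z_n) :
  (2 < n)%N -> cycle_color a <> cycle_color (a + 1).
Proof.
move=> n_gt2; have n_gt1 := ltnW n_gt2.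
have b3 (b : bool) : (b < 3)%N by case: b.
rewrite /cycle_color; case: (eqVneq a (-1)) => [->|a_neq].
  rewrite addNr; case: eqP => [e|_].
    have : (n %| 1)%N; last by rewrite dvdn1; lia.
    have e1 : (1%:R : 'Z_n) = 0 by rewrite -[LHS]opprK -e oppr0.
    by rewrite /dvdn -(val_Zp_nat n_gt1) e1.
  by move=> /(congr1 val); rewrite /= !inordK.
(* Away from [-1] the successor does not wrap around, so its parity flips. *)
have val_a1 : (a + 1 : 'Z_n) = a.+1 :> nat.
  have -> : a + 1 = a.+1%:R by rewrite -natr1 natr_Zp.
  rewrite val_Zp_nat // modn_small //.
  have : (a < n)%N by rewrite -[X in (_ < X)%N](Zp_cast n_gt1) ltn_ord.
  rewrite leq_eqVlt => /orP[/eqP en|//].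
  case/eqP: a_neq; apply/eqP; rewrite -addr_eq0 -[a]natr_Zp natr1 en.
  by rewrite pchar_Zp.
by move=> /(congr1 val); rewrite val_a1; case: ifP => _; rewrite /= !inordK //=; case: odd.
Qed.

Lemma Cay_chromatic3_odd (G : zmodType) (n : nat) (f : {additive G -> 'Z_n}) (g : G) :
  (1 < n)%N -> odd n -> f g = 1 ->
  exists S : set G, symmetric_subset S /\ connected_graph (Cay S)
    /\ has_chromatic_number (Cay S) 3.
Proof.
move=> n_gt1 odd_n fg; have n_gt2 : (2 < n)%N by lia.
(* The even multiple is [n.-1], which represents [-1]. *)
apply: (@Cay_preimage_chromatic3 _ _ f g n_gt1 fg [set a | a = 1 \/ a = -1]
  (@cycle_color n) n.-1) => /=.
- by move=> a; split=> [[->|->]|[e|e]];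
    [right|left; rewrite opprK|right; rewrite -[a]opprK e|left; rewrite -[a]opprK e opprK].
- by left.
- right; apply/eqP; rewrite -addr_eq0 natr1 prednK ?pchar_Zp //; lia.
- by lia.
- move=> a t [] -> ; first exact: cycle_color_succ.
  by move/esym; rewrite -{2}[a](subrK 1); apply: cycle_color_succ.
Qed.

Lemma Cay_chromatic3_8 (G : zmodType) (f : {additive G -> 'Z_8}) (g : G) :
  f g = 1 ->
  exists S : set G, symmetric_subset S /\ connected_graph (Cay S)
    /\ has_chromatic_number (Cay S) 3.
Proof.
(* The octagon given by [1] and [-1] is bipartite; the chords by [4 = -4] create 5-cycles such as 0,
   1, 2, 3, 4. *)
move=> fg; pose T := [:: 1; -1; 4%:R] : seq 'Z_8.
pose c (a : 'Z_8) : 'I_3 := inord (nth 0%N [:: 0; 1; 0; 1; 2; 0; 1; 2] a)%N.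
apply: (@Cay_preimage_chromatic3 _ 8 f g isT fg [set` T] c 4) => //=.
- by case=> [[|[|[|[|[|[|[|[|//]]]]]]]] ?]; split.
- move=> a t tT.
  move: t a tT.
  by case=> [[|[|[|[|[|[|[|[|//]]]]]]]] ?] [[|[|[|[|[|[|[|[|//]]]]]]]] ?] //= _;
    rewrite /c /= => /(congr1 val) /=; rewrite !inordK.
Qed.

(** * Extension of characters with values in Z/n *)

Section Characters.

Variables (G : zmodType) (n : nat).
Hypothesis n_gt1 : (1 < n)%N.

(* The graph of a homomorphism to Z/n defined on a subgroup containing nG and
   vanishing on nG. *)
Definition partial_character (R : G -> 'Z_n -> Prop) : Prop :=
  [/\ forall x, R (x *+ n) 0,
      forall x y a b, R x a -> R y b -> R (x - y) (a - b)
    & forall a, R 0 a -> a = 0].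

Lemma partial_characterMz R x a (k : int) :
  partial_character R -> R x a -> R (x *~ k) (a *~ k).
Proof.
move=> [Rn RB _] Rx; have R0 : R 0 0 by have := Rn 0; rewrite mul0rn.
have RN y b : R y b -> R (- y) (- b) by move=> /(RB _ _ _ _ R0); rewrite !sub0r.
have RMn j : R (x *+ j) (a *+ j).
  elim: j => [|j IH]; first by rewrite !mulr0n.
  by rewrite !mulrS -(opprK (x *+ j)) -(opprK (a *+ j)); apply: RB => //; apply: RN.
by case: k => j; rewrite ?NegzE ?mulrNz; [|apply: RN]; apply: RMn.
Qed.

Lemma partial_character_inj R x a b :
  partial_character R -> R x a -> R x b -> a = b.
Proof.
move=> [_ RB R0] Ra Rb; apply/eqP; rewrite -subr_eq0; apply/eqP/R0.
by rewrite -(subrr x); apply: RB.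
Qed.

(** For a partial character [R], this is the subgroup of the product generated by [R] and the pair
    [(x, b)]. *)
Definition adjoin_value (R : G -> 'Z_n -> Prop) (x : G) (b : 'Z_n) : G -> 'Z_n -> Prop :=
  fun y a => exists k : int, R (y - x *~ k) (a - b *~ k).

Lemma sub_adjoin_value R x b y a : R y a -> adjoin_value R x b y a.
Proof. by exists 0; rewrite !mulr0z !subr0. Qed.

Lemma mem_adjoin_value R x b : partial_character R -> adjoin_value R x b x b.
Proof. by case=> Rn _ _; exists 1; rewrite !mulr1z !subrr; have := Rn 0; rewrite mul0rn. Qed.

Lemma partial_character_adjoin R x b :
  partial_character R -> (forall (k : int) a, R (x *~ k) a -> a = b *~ k) ->
  partial_character (adjoin_value R x b).
Proof.
move=> [Rn RB R0] xb; split.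
- by move=> y; apply: sub_adjoin_value.
- move=> y z a d [k Rk] [l Rl]; exists (k - l).
  have E (V : zmodType) (u v w : V) : u - v - w *~ (k - l) = u - w *~ k - (v - w *~ l).
    by rewrite mulrzBr !opprD !opprK !addrA; congr (_ + _); rewrite addrAC.
  by rewrite !E; apply: RB.
- move=> a [k]; rewrite sub0r -mulrNz => /xb /eqP.
  by rewrite mulrNz subr_eq addNr => /eqP.
Qed.

(* Z/n is injective among abelian groups killed by n. *)
Lemma partial_character_extension_value R x : partial_character R ->
  exists b : 'Z_n, forall (k : int) a, R (x *~ k) a -> a = b *~ k.
Proof.
move=> HR; have [Rn RB R0] := HR.
pose P m := `[< (0 < m)%N /\ exists a, R (x *+ m) a >].
have exP : exists m, P m.
  by exists n; apply/asboolP; split; [lia | exists 0].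
case: (ex_minnP exP) => m /asboolP[m_gt0 [a Ra]] minm.
(* By division with remainder, the multiples of [x] in the domain are those of [x *+ m], by
   minimality of [m]. *)
have dvd_m (k : int) d : R (x *~ k) d -> (m %| k)%Z.
  move=> Rk; apply/dvdz_mod0P.
  have := divz_eq k m; set q := (k %/ m)%Z; set r := (k %% m)%Z => ek.
  have r_ge0 : 0 <= r by apply: modz_ge0; lia.
  have r_lt : r < m%:Z by apply: ltz_pmod; lia.
  case: (eqVneq r 0) => // r_neq0.
  suff /minm : P `|r|%N by lia.
  apply/asboolP; split; first by lia.
  exists (d - a *~ q).
  have -> : x *+ `|r|%N = x *~ k - (x *+ m) *~ q.
    rewrite -[x *+ m]/(x *~ m%:Z) -mulrzA mulrC -mulrzBr ek addrC addKr.
    by rewrite -[x *+ _]/(x *~ `|r|%N%:Z) gez0_abs.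
  by apply: RB => //; apply: partial_characterMz.
have /dvdzP[d' en] : (m %| n%:Z)%Z by apply: (dvd_m _ 0); apply: Rn.
have {d' en} /dvdnP[d en] : (m %| n)%N by apply/dvdnP; exists `|d'|%N; nia.
have ad0 : a *+ d = 0.
  apply: (@partial_character_inj R (x *+ n)) => //.
  have -> : x *+ n = x *+ m *+ d by rewrite en mulnC mulrnA.
  exact: (partial_characterMz d%:Z HR Ra).
(* With [n = d * m], the relation [a *+ d = 0] says that [d * m] divides [a * d]; the quotient of
   [a] by [m] is the value sought. *)
have /dvdnP[b eb] : (m %| a)%N.
  have : (d * m %| a * d)%N.
    by rewrite -en /dvdn -(val_Zp_nat n_gt1) natrM natr_Zp mulr_natr ad0.
  by rewrite [(d * m)%N]mulnC dvdn_pmul2r //; nia.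
exists b%:R => k e Rk.
have /dvdzP[q ek] := dvd_m _ _ Rk.
apply: (partial_character_inj HR Rk); rewrite ek mulrC !mulrzA.
have -> : (b%:R : 'Z_n) *~ m = a by rewrite -[RHS]natr_Zp eb natrM mulr_natr.
exact: partial_characterMz.
Qed.

Lemma partial_character_extension R (l : seq G) : partial_character R ->
  exists R', [/\ partial_character R', forall x a, R x a -> R' x a
    & forall x, x \in l -> exists a, R' x a].
Proof.
elim: l R => [|x l IH] R HR; first by exists R.
have [b xb] := partial_character_extension_value x HR.
have [R' [HR' sub' tot']] := IH _ (partial_character_adjoin HR xb).
exists R'; split=> //.
  by move=> y a Ry; apply/sub'/sub_adjoin_value.
move=> y; rewrite inE => /orP[/eqP->|/tot' //].
by exists b; apply/sub'/mem_adjoin_value.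
Qed.

(** The hypothesis gives [g] order [n] in G/nG, so [g] may be sent to [1] consistently with 0 on nG;
    adjoining the generators makes the character total. *)
Lemma character_of_order (g : G) : finitely_generated G ->
  (forall (k : int) h, g *~ k = h *+ n -> (n %| k)%Z) ->
  exists f : {additive G -> 'Z_n}, f g = 1.
Proof.
move=> [r [X genX]] ordg.
pose R0 (x : G) (a : 'Z_n) := a = 0 /\ exists h, x = h *+ n.
have HR0 : partial_character R0.
  split=> [x|x y a b [-> [h ->]] [-> [h' ->]]|a []//].
    by split=> //; exists x.
  by split; [rewrite subr0 | exists (h - h'); rewrite mulrnBl].
have g1 (k : int) a : R0 (g *~ k) a -> a = 1 *~ k.
  move=> [-> [h /ordg /dvdzP[q ->]]].
  by rewrite mulrC mulrzA -[1 *~ n]/(n%:R) pchar_Zp // mul0rz.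
have HR1 := partial_character_adjoin HR0 g1.
have [R [HR subR totX]] := partial_character_extension X HR1.
have [Rn RB _] := HR.
have tot x : exists a, R x a.
  have [a ->] := genX x.
  elim/big_ind: _ => [|y z [b Ry] [d Rz]|i _].
  - by exists 0; have := Rn 0; rewrite mul0rn.
  - exists (b - (0 - d)); rewrite -(opprK z) -[- z]sub0r; apply: (RB) => //; apply: (RB) => //.
    by have := Rn 0; rewrite mul0rn.
  - have [b Rb] := totX X`_i (mem_nth _ (etrans (congr1 _ (size_tuple X)) (ltn_ord i))).
    by exists (b *~ a i); apply: partial_characterMz.
have [f Rf] := choice tot.
have fB : zmod_morphism f.
  by move=> x y; apply: (partial_character_inj HR (Rf _)); apply: RB.
pose F : {additive G -> 'Z_n} := HB.pack f (GRing.isZmodMorphism.Build _ _ f fB).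
exists F; apply: (partial_character_inj HR (Rf g)).
by apply/subR/mem_adjoin_value.
Qed.

End Characters.

(** * Existence of characters, and divisible groups *)

Lemma character_of_prime_power_order (G : zmodType) (p j : nat) (g : G) :
  finitely_generated G -> prime p -> (forall h, g *+ p ^ j <> h *+ p ^ j.+1) ->
  exists f : {additive G -> 'Z_(p ^ j.+1)}, f g = 1.
Proof.
move=> fgG p_pr gj; have p_gt1 := prime_gt1 p_pr.
apply: character_of_order => //; first by rewrite -(exp1n j.+1) ltn_exp2r.
move=> k h gk.
(* If the gcd were [p ^ i] with [i <= j], Bezout would put [g *+ p ^ i], hence [g *+ p ^ j], among
   the multiples of [p ^ j.+1]. *)
have [u [v uv]] := Bezoutz k (p ^ j.+1)%N.
have /(dvdn_pfactor _ _ p_pr)[i le_ij ei] : (gcdn `|k| (p ^ j.+1) %| p ^ j.+1)%N.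
  exact: dvdn_gcdr.
have [lt_ij|ge_ij] := ltnP i j.+1.
  case: (gj ((h *~ u + g *~ v) *+ p ^ (j - i))).
  have -> : g *+ p ^ j = g *+ p ^ i *+ p ^ (j - i) by rewrite -mulrnA -expnD subnKC.
  rewrite [RHS]mulrnAC; congr (_ *+ _).
  rewrite -ei -[g *+ _]/(g *~ (gcdz k (p ^ j.+1)%N)) -uv mulrzDr [u * k]mulrC (mulrzA g k u) gk.
  by rewrite mulrzA mulrnDl pmulrn mulrzAC.
have -> : (p ^ j.+1 = gcdn `|k| (p ^ j.+1))%N by rewrite ei; congr (_ ^ _)%N; lia.
by rewrite dvdzE /= dvdn_gcdl.
Qed.

(* Nakayama's lemma in its determinant form. *)
Lemma annihilates_of_divisible (G : zmodType) (p : nat) : (1 < p)%N ->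
  finitely_generated G -> (forall g : G, exists h, g = h *+ p) ->
  exists k, annihilates G k.
Proof.
move=> p_gt1 [r [X genX]] divG.
have divX (i : 'I_r) : exists a : int ^ r, X`_i = (\sum_(j < r) X`_j *~ a j) *+ p.
  by have [h ->] := divG X`_i; have [a ->] := genX h; exists a.
have [a Ha] := choice divX.
(* [A] kills the vector of generators, hence so does its determinant, by the adjugate; modulo [p] it
   is the identity, so the determinant is nonzero. *)
pose A : 'M[int]_r := 1%:M - p%:Z *: \matrix_(i, j) a i j.
have AX i : \sum_(j < r) X`_j *~ A i j = 0.
  under eq_bigr do rewrite !mxE mulrzBr.
  rewrite sumrB; apply/eqP; rewrite subr_eq0; apply/eqP.
  rewrite (bigD1 i) //= eqxx big1 ?addr0; last by move=> j /negPf ji; rewrite eq_sym ji.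
  rewrite mulr1z {1}Ha pmulrn mulrz_suml; apply: eq_bigr => j _.
  by rewrite -mulrzA mulrC.
have dX (i : 'I_r) : X`_i *~ \det A = 0 :> G.
  transitivity (\sum_(j < r) X`_j *~ (\adj A *m A) i j).
    rewrite mul_adj_mx (bigD1 i) //= big1 ?addr0 ?mxE ?eqxx //.
    by move=> j /negPf ji; rewrite !mxE eq_sym ji.
  under eq_bigr do rewrite mxE mulrz_sumr.
  rewrite exchange_big big1 //= => k _.
  under eq_bigr do rewrite mulrC mulrzA.
  by rewrite -mulrz_suml AX mul0rz.
have d_neq0 : \det A != 0.
  apply/eqP => d0.
  have /eqP := det_map_mx (intmul (1 : 'Z_p)) A.
  rewrite d0 rmorph0.
  have -> : map_mx (intmul 1) A = 1%:M :> 'M['Z_p]_r.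
    apply/matrixP => i j; rewrite !mxE rmorphB rmorphM /= -[p%:~R]/(p%:R) pchar_Zp //.
    by rewrite mul0r subr0; case: eqP.
  by rewrite det1 oner_eq0.
exists `|\det A|%N; split; first by rewrite absz_gt0.
move=> g; have [b ->] := genX g.
have : (\sum_(i < r) X`_i *~ b i) *~ \det A = 0.
  rewrite mulrz_suml big1 // => i _.
  by rewrite -mulrzA mulrC mulrzA dX mul0rz.
by case: (\det A) => k //; rewrite NegzE mulrNz => /eqP; rewrite oppr_eq0 => /eqP.
Qed.

Lemma exponent_eq0 (G : zmodType) : exponent G = 0%N -> ~ exists k, annihilates G k.
Proof.
rewrite /exponent; case: pselect => // exk; case: ex_minnP => m /asboolP[m_gt0 _] _ m0.
by rewrite m0 in m_gt0.
Qed.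

Lemma exponent_gt0 (G : zmodType) : (0 < exponent G)%N ->
  annihilates G (exponent G) /\ forall k, annihilates G k -> (exponent G <= k)%N.
Proof.
rewrite /exponent; case: pselect => // exk _; case: ex_minnP => m /asboolP Gm minm.
by split=> // k Gk; apply/minm/asboolP.
Qed.

(** With exponent [m * p ^ j.+1], minimality gives [g] not killed by [m * p ^ j]; then [g *+ p ^ j]
    is no multiple of [p ^ j.+1], as [m] would kill it. *)
Lemma character_of_dvdn_exponent (G : zmodType) (p j : nat) :
  finitely_generated G -> prime p -> (0 < exponent G)%N ->
  (p ^ j.+1 %| exponent G)%N ->
  exists (f : {additive G -> 'Z_(p ^ j.+1)}) (g : G), f g = 1.
Proof.
move=> fgG p_pr /exponent_gt0[[e_gt0 Ge] mine] /dvdnP[m em].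
have p_gt1 := prime_gt1 p_pr.
have m_gt0 : (0 < m)%N by move: e_gt0; rewrite em; case: (m).
have pj_gt0 : (0 < p ^ j)%N by rewrite expn_gt0 (ltnW p_gt1).
have [g gm] : exists g : G, g *+ (m * p ^ j) <> 0.
  apply: contrapT => /forallNP G0.
  have : annihilates G (m * p ^ j).
    by split=> [|g]; [rewrite muln_gt0 m_gt0 | exact: contrapT (G0 g)].
  by move/mine; rewrite em expnS; nia.
have [|f fg] := @character_of_prime_power_order G p j g fgG p_pr; last by exists f, g.
move=> h gh; apply: gm.
by rewrite mulnC mulrnA gh -mulrnA mulnC -em Ge.
Qed.

Local Close Scope ring_scope.

Theorem theorem5p1 (G : zmodType) (fgG : finitely_generated G) :
  (exists S : set G,
     symmetric_subset S /\ connected_graph (Cay S)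
     /\ has_chromatic_number (Cay S) 3)
  <-> exponent G \notin [:: 1; 2; 4].
Proof.
split.
  move=> [S [symS [conS chi3]]]; apply/negP => e124.
  apply: (Cay_chromatic_neq3 _ symS conS chi3) => g.
  have [|[_ Ge] _] := @exponent_gt0 G; first by move: e124; case: exponent.
  (* The excluded values are exactly the divisors of 4. *)
  have /dvdnP[q ->] : (exponent G %| 4).
    by move: e124; rewrite !inE => /or3P[] /eqP->.
  by rewrite mulnC mulrnA Ge mul0rn.
case: (posnP (exponent G)) => [e0 _|e_gt0 e124].
  have [g g3] : exists g : G, forall h, g <> (h *+ 3)%R.
    apply: contrapT => /forallNP G3; apply: (exponent_eq0 e0).
    apply: (@annihilates_of_divisible G 3) => // g.
    by have /existsNP[h /contrapT ?] := G3 g; exists h.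
  have [|f fg] := @character_of_prime_power_order G 3 0 g fgG isT; first exact: g3.
  exact: (@Cay_chromatic3_odd _ _ f g).
have [[p [p_pr odd_p dvd_p]]|no_odd] :=
    pselect (exists p, [/\ prime p, odd p & (p %| exponent G)]).
  have [|f [g fg]] := @character_of_dvdn_exponent G p 0 fgG p_pr e_gt0; first by rewrite expn1.
  by apply: (@Cay_chromatic3_odd _ _ f g); rewrite ?expn1 ?prime_gt1.
(* Without odd prime divisors the exponent is a power of 2; as it is not 1, 2 or 4, it is divisible
   by 8. *)
have /p_natP[k ek] : 2.-nat (exponent G).
  apply/pnatP => // p p_pr dvd_p; rewrite inE.
  by case/even_prime: (p_pr) => [->//|odd_p]; case: no_odd; exists p.
have [|f [g fg]] := @character_of_dvdn_exponent G 2 2 fgG isT e_gt0; last exact: Cay_chromatic3_8 fg.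
by move: e124; rewrite ek; case: k {ek} => [|[|[|k]]] // _; apply: dvdn_exp2l.
Qed.
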